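(* If $G$ is a connected cubic graph of order $n = 14$, then $$\mathrm{pd}_{\frac{7}{8}}(G) \le 4 < \frac{1}{3}n.$$
   Context: Graphs are finite, simple and undirected; the order of a graph is its number of vertices. A cubic graph is a graph in which every vertex has degree $3$. For a vertex $v$ of a graph $G$, $N_G[v]$ denotes the closed neighborhood of $v$ ($v$ together with all its neighbors), and for $S \subseteq V(G)$, $N_G[S] = \bigcup_{v\in S} N_G[v]$. For $0 < \alpha \le 1$ and a graph $G$ of order $n$, a set $S \subseteq V(G)$ is an $\alpha$-partial dominating set of $G$ if $|N_G[S]| \ge \alpha \times n$. The $\alpha$-partial domination number $\mathrm{pd}_{\alpha}(G)$ is the minimum cardinality of an $\alpha$-partial dominating set of $G$. *)

(* Defs.v *)
From mathcomp Require Import all_boot all_order all_algebra.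

Set Implicit Arguments.
Unset Strict Implicit.
Unset Printing Implicit Defensive.

Import Order.TTheory GRing.Theory Num.Theory.

Record sgraph := SGraph {
  vertex :> finType;
  edge : rel vertex;
  edge_sym : symmetric edge;
  edge_irr : irreflexive edge
}.

Definition order_of (G : sgraph) : nat := #|G|.

Definition degree (G : sgraph) (v : G) : nat := #|[set u | edge v u]|.

Definition cubic (G : sgraph) : Prop := forall v : G, degree v = 3.

(* The empty graph counts as connected. *)
Definition connected (G : sgraph) : Prop :=
  forall u v : G, connect (@edge G) u v.

Definition closed_nbhd (G : sgraph) (v : G) : {set G} :=
  v |: [set u | edge v u].

Definition closed_nbhds (G : sgraph) (S : {set G}) : {set G} :=
  \bigcup_(v in S) closed_nbhd v.

Definition partial_dominating (R : realFieldType) (alpha : R) (G : sgraph)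
    (S : {set G}) : bool :=
  (alpha * (order_of G)%:R <= #|closed_nbhds S|%:R)%R.

(* For alpha <= 1 the whole vertex set is alpha-partial dominating, so the
   minimum is attained; outside this range the value carries no meaning. *)
Definition pd (R : realFieldType) (alpha : R) (G : sgraph) : nat :=
  #|[arg min_(S < [set: G] | partial_dominating alpha S) #|S|]|.

Lemma partial_dominatingT (R : realFieldType) (alpha : R) (G : sgraph) :
  (alpha <= 1)%R -> partial_dominating alpha [set: G].
Proof.
move=> le_a1; rewrite /partial_dominating.
have -> : closed_nbhds [set: G] = [set: G].
  by apply/setP=> v; rewrite inE; apply/bigcupP; exists v; rewrite ?inE ?eqxx.
by rewrite cardsT -[leRHS]mul1r ler_wpM2r.
Qed.

Lemma pd_leP (R : realFieldType) (alpha : R) (G : sgraph) (k : nat) :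
  (alpha <= 1)%R ->
  reflect (exists2 S : {set G}, partial_dominating alpha S & #|S| <= k)
          (pd alpha G <= k).
Proof.
move=> /partial_dominatingT aT; rewrite /pd.
case: arg_minnP => [|S aS minS]; first exact: aT.
apply: (iffP idP) => [leSk | [S' aS' leS'k]]; first by exists S.
exact: leq_trans (minS _ aS') leS'k.
Qed.

(* Main.v *)
Require Import Defs.
From mathcomp Require Import all_boot all_order all_algebra.
From mathcomp Require Import zify lra.

(** Since 7/8 * 14 = 12.25, the claim is that four closed neighbourhoods, of
    four vertices each, can be chosen to cover at least 13 of the 14 vertices.

    Suppose that any four cover at most 12.  Then three never cover 12, since
    a fourth could be centred at an uncovered vertex; in particular no three
    closed neighbourhoods are pairwise disjoint ([three_cover_le11]).  Three
    cannot cover 11 either: two of the three uncovered vertices would have a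
    common closed neighbour, and centring the fourth there would cover 13
    ([three_cover_le10]).  Hence, if N[a] and N[b] are disjoint and W is the
    set of the six vertices outside them, every N[u] meets W in at most two
    vertices.

    Counting the edges between W and N(a) :|: N(b) from both sides shows that
    all these bounds are attained: every vertex of W, and every neighbour of a
    or b, has exactly two vertices of W in its closed neighbourhood
    ([outside_card2]).  So the neighbours b1, b2, b3 of b have no neighbour in
    N[a], and the pairs (a, b1), (a, b2), (a, b3) can replace (a, b).  The
    bound for (a, b2) forces b2 and b3 to have a common neighbour p in W.  If
    p is not adjacent to b1, then p, b2 and b3 contradict the bound for
    (a, b1); if it is, then N[p] = {p, b1, b2, b3} has only one vertex in W. *)

Local Notation "N[ v ]" := (closed_nbhd v) (at level 0, v at level 99).

(** * Closed neighbourhoods *)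

Lemma closed_nbhd_refl (G : sgraph) (v : G) : v \in N[v].
Proof. by rewrite !inE eqxx. Qed.

Lemma closed_nbhdC (G : sgraph) (u v : G) : (u \in N[v]) = (v \in N[u]).
Proof. by rewrite !inE eq_sym edge_sym. Qed.

Lemma card_closed_nbhd (G : sgraph) (v : G) : cubic G -> #|N[v]| = 4.
Proof.
move=> /(_ v); rewrite /degree /closed_nbhd => degv.
by rewrite cardsU1 degv inE edge_irr.
Qed.

(** All the closed neighbourhoods N[u] with u in N[a] contain a, so together
    they have at most 1 + 4 * 3 = 13 vertices, and any vertex b outside their
    union will do. *)
Lemma ex_disjoint_nbhd (G : sgraph) (a : G) :
  cubic G -> 13 < #|G| -> exists b, [disjoint N[a] & N[b]].
Proof.
move=> Gc G14.
have bound : #|a |: \bigcup_(u in N[a]) (N[u] :\ a)| <= 13.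
  rewrite cardsU1; apply: (@leq_add _ _ 1 12); first by case: (_ \notin _).
  have unionB (A : {set G}) : #|\bigcup_(u in A) (N[u] :\ a)| <=
                              \sum_(u in A) #|N[u] :\ a|.
    elim/big_rec2: _ => [|u m X _ le_Xm]; first by rewrite cards0.
    exact: leq_trans (leq_card_setU _ _) (leq_add _ le_Xm).
  apply: leq_trans (unionB _) _.
  rewrite (eq_bigr (fun=> 3)); first by rewrite sum_nat_const card_closed_nbhd.
  move=> u ua; have := cardsD1 a N[u].
  by rewrite card_closed_nbhd // closed_nbhdC ua => -[].
have [b _ bU] : exists2 b, b \in [set: G] &
    b \notin a |: \bigcup_(u in N[a]) (N[u] :\ a).
  apply/subsetPn; apply: contraL G14 => /subset_leq_card.
  by rewrite cardsT -leqNgt => /leq_trans; apply.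
exists b; apply/pred0P => u /=; apply/negP => /andP[ua ub].
case/negP: bU; rewrite inE in_set1.
have [//|ba] := eqVneq b a; apply/bigcupP; exists u => //.
by rewrite in_setD1 ba closed_nbhdC.
Qed.

Lemma cardsU_disjoint (T : finType) (A B : {set T}) :
  [disjoint A & B] -> #|A :|: B| = #|A| + #|B|.
Proof. by move=> AB; apply/eqP; rewrite (leq_card_setU A B). Qed.

Lemma cards3 (T : finType) (x y z : T) :
  x != y -> y != z -> z != x -> #|[set x; y; z]| = 3.
Proof.
move=> xy yz zx; rewrite setUC cardsU1 cards2 xy !inE.
by rewrite (negPf zx) (eq_sym z) (negPf yz).
Qed.

Lemma sum_card_setI_sym (T : finType) (r : rel T) (A B : {set T}) :
  symmetric r ->
  \sum_(x in A) #|[set y in B | r x y]| = \sum_(y in B) #|[set x in A | r y x]|.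
Proof.
move=> r_sym.
have count (C D : {set T}) : \sum_(x in C) #|[set y in D | r x y]| =
    \sum_(x in C) \sum_(y in D) r x y.
  apply: eq_bigr => x _; rewrite -sum1_card big_mkcond [RHS]big_mkcond /=.
  by apply: eq_bigr => y _; rewrite inE; case: (y \in D); case: (r x y).
rewrite !count exchange_big /=.
by apply: eq_bigr => y _; apply: eq_bigr => x _; rewrite r_sym.
Qed.

Lemma eq_sum_bound (T : finType) (A : {set T}) (F : T -> nat) (k : nat) :
  (forall x, x \in A -> F x <= k) -> #|A| * k <= \sum_(x in A) F x ->
  forall x, x \in A -> F x = k.
Proof.
move=> Fk sumF x xA; apply/eqP; rewrite eqn_leq Fk //=.
have rest : \sum_(y in A | y != x) F y <= (#|A| - 1) * k.
  rewrite (cardsD1 x A) xA addKn -sum_nat_const.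
  rewrite [leqRHS](eq_bigl (fun y => (y \in A) && (y != x))).
    by apply: leq_sum => y /andP[/Fk].
  by move=> y; rewrite !inE andbC.
rewrite (bigD1 x) //= in sumF.
have A_gt0 : 0 < #|A| by apply/card_gt0P; exists x.
nia.
Qed.

(** * Graphs in which four closed neighbourhoods cover at most 12 vertices *)

Definition four_cover_le12 (G : sgraph) : Prop :=
  forall a b c d : G, #|N[a] :|: N[b] :|: N[c] :|: N[d]| <= 12.

(** A fourth closed neighbourhood, centred at any vertex that three covering
    12 leave out, would bring the total to 13.  This excludes three pairwise
    disjoint closed neighbourhoods as well, since those cover 12. *)
Lemma three_cover_le11 (G : sgraph) (a b c : G) :
  #|G| = 14 -> four_cover_le12 G -> #|N[a] :|: N[b] :|: N[c]| <= 11.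
Proof.
move=> G14 le12; set D := _ :|: _.
rewrite -ltnS ltn_neqAle (leq_trans _ (le12 a b c c)); last first.
  by rewrite subset_leq_card // subsetUl.
rewrite andbT; apply/eqP => D12.
have [d] : exists d, d \in ~: D by apply/card_gt0P; rewrite cardsCs setCK; lia.
rewrite inE => dD.
have := le12 a b c d; rewrite leqNgt -/D => /negP; apply.
have /subset_leq_card : d |: D \subset D :|: N[d].
  by rewrite subUset subsetUl sub1set inE closed_nbhd_refl orbT.
by rewrite cardsU1 dD D12.
Qed.

(** Three closed neighbourhoods covering 11 vertices leave out x, y and z.  If
    some v is a closed neighbour of two of these, then N[v] is a fourth set
    bringing the total to 13; otherwise N[x], N[y] and N[z] are pairwise
    disjoint, which [three_cover_le11] excludes. *)
Lemma three_cover_le10 (G : sgraph) (a b c : G) :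
  cubic G -> #|G| = 14 -> four_cover_le12 G ->
  #|N[a] :|: N[b] :|: N[c]| <= 10.
Proof.
move=> Gc G14 le12; set D := _ :|: _.
rewrite leqNgt; apply/negP => D11.
have D11' : #|D| <= 11 := three_cover_le11 _ a b c G14 le12.
have coverD v : #|D :|: N[v]| <= 12 := le12 a b c v.
clearbody D.
have disj x y : x \in ~: D -> y \in ~: D -> x != y -> [disjoint N[x] & N[y]].
  rewrite !inE => xD yD xy; apply/pred0P => v /=; apply/negP => /andP[vx vy].
  have := coverD v; rewrite leqNgt => /negP; apply.
  have /subset_leq_card : x |: (y |: D) \subset D :|: N[v].
    rewrite subUset sub1set subUset sub1set subsetUl andbT.
    by rewrite !(in_setU _ D) !(closed_nbhdC _ _ v) vx vy !orbT.
  by apply: leq_trans; rewrite !cardsU1 !in_setU in_set1 (negPf xy) xD yD; lia.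
have /card_gt2P[x [y [z [[xD yD zD] [xy yz zx]]]]] : 2 < #|~: D|.
  by rewrite cardsCs setCK; lia.
have := three_cover_le11 _ x y z G14 le12.
rewrite cardsU_disjoint; last first.
  by rewrite -setI_eq0 setIUl setU_eq0 !setI_eq0 !disj // eq_sym.
by rewrite cardsU_disjoint ?disj // !card_closed_nbhd.
Qed.

(** * Two disjoint closed neighbourhoods and the six vertices outside them *)

Lemma card_disjoint_nbhds (G : sgraph) (a b : G) :
  cubic G -> [disjoint N[a] & N[b]] -> #|N[a] :|: N[b]| = 8.
Proof. by move=> Gc ab; rewrite cardsU_disjoint // !card_closed_nbhd. Qed.

(** N[a] and N[b] already cover 8 of the at most 10 vertices. *)
Lemma outside_le2 (G : sgraph) (a b u : G) :
  cubic G -> #|G| = 14 -> four_cover_le12 G -> [disjoint N[a] & N[b]] ->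
  #|N[u] :\: (N[a] :|: N[b])| <= 2.
Proof.
move=> Gc G14 le12 ab; have := three_cover_le10 _ a b u Gc G14 le12.
have := cardsUI (N[a] :|: N[b]) N[u]; rewrite setIC.
have := cardsID (N[a] :|: N[b]) N[u].
rewrite card_disjoint_nbhds //; lia.
Qed.

(** Put D = N[a] :|: N[b] and D' = D :\: [set a; b], which has six vertices,
    as has the complement W of D.  Each vertex of W has at least two of its
    four closed neighbours in D', each vertex of D' has at most two in W, and
    6 * 2 = 6 * 2: there is equality everywhere. *)
Lemma outside_card2 (G : sgraph) (a b u : G) :
  cubic G -> #|G| = 14 -> four_cover_le12 G -> [disjoint N[a] & N[b]] ->
  u != a -> u != b -> #|N[u] :\: (N[a] :|: N[b])| = 2.
Proof.
move=> Gc G14 le12 ab ua ub; set D := N[a] :|: N[b].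
have aD : a \in D by rewrite inE closed_nbhd_refl.
have bD : b \in D by rewrite inE closed_nbhd_refl orbT.
have neq_ab : a != b.
  apply: contraTneq ab => <-; apply/pred0Pn; exists a.
  by rewrite /= closed_nbhd_refl.
have D8 : #|D| = 8 := card_disjoint_nbhds _ a b Gc ab.
pose D' := D :\: [set a; b].
have D'6 : #|D'| = 6.
  have := cardsID [set a; b] D; rewrite D8 (setIidPr _).
    by rewrite cards2 neq_ab => -[].
  by rewrite subUset !sub1set aD bD.
have W6 : #|~: D| = 6 by rewrite cardsCs setCK G14 D8.
have le2 v : #|N[v] :\: D| <= 2 by apply: outside_le2.
pose adj (x y : G) := y \in N[x].
have adj_sym : symmetric adj by move=> x y; rewrite /adj closed_nbhdC.
have := sum_card_setI_sym _ adj (~: D) D' adj_sym.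
rewrite [RHS](eq_bigr (fun v => #|N[v] :\: D|)); last first.
  by move=> v _; apply: eq_card => w; rewrite /adj !inE.
have splitW w : w \in ~: D -> #|[set v in D' | adj w v]| + #|N[w] :\: D| = 4.
  rewrite in_setC => wD; rewrite -(card_closed_nbhd _ w) //.
  rewrite -(cardsID D N[w]); congr (_ + _).
  apply: eq_card => v; rewrite inE [RHS]inE andbC /D' in_setD /adj.
  have [vw|//] /= := boolP (v \in N[w]).
  suff -> : v \notin [set a; b] by [].
  apply: contra wD; rewrite in_set2 => /orP[] /eqP vE;
    by rewrite in_setU -vE !(closed_nbhdC _ w) vw ?orbT.
have sumW : \sum_(w in ~: D) #|[set v in D' | adj w v]| +
            \sum_(w in ~: D) #|N[w] :\: D| = 24.
  by rewrite -big_split (eq_bigr (fun=> 4)) // sum_nat_const W6.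
have leW : \sum_(w in ~: D) #|N[w] :\: D| <= 12.
  apply: (@leq_trans (\sum_(w in ~: D) 2)); first exact: leq_sum.
  by rewrite sum_nat_const W6.
have leD' : \sum_(v in D') #|N[v] :\: D| <= 12.
  apply: (@leq_trans (\sum_(v in D') 2)); first exact: leq_sum.
  by rewrite sum_nat_const D'6.
move=> sumE; have [uD|uW] := boolP (u \in D).
  apply: (eq_sum_bound _ D' (fun v => #|N[v] :\: D|)) => //.
    by rewrite D'6; lia.
  by rewrite in_setD in_set2 (negPf ua) (negPf ub).
apply: (eq_sum_bound _ (~: D) (fun v => #|N[v] :\: D|)) => //.
  by rewrite W6; lia.
by rewrite in_setC.
Qed.

(** Equality in the count for (a, b) makes each neighbour c of b another
    vertex whose closed neighbourhood is disjoint from N[a], so the upper bound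
    [outside_le2] also holds for the pairs (a, c); these bounds are
    incompatible with each other. *)
Lemma four_cover_le12_false (G : sgraph) :
  cubic G -> #|G| = 14 -> ~ four_cover_le12 G.
Proof.
move=> Gc G14 le12.
have /card_gt0P[a _] : 0 < #|G| by rewrite G14.
have [|b ab] := ex_disjoint_nbhd _ a Gc; first by rewrite G14.
set D := N[a] :|: N[b].
have notNa c : c \in N[b] -> c \notin N[a].
  by move=> cb; apply: contraTN ab => ca; apply/pred0Pn; exists c; rewrite /= ca.
have cardD v : v != a -> v != b -> #|N[v] :&: D| = 2.
  move=> va vb; have := cardsID D N[v].
  by rewrite card_closed_nbhd // outside_card2 // => /(@addIn _ _ 2).
have neq_a c : c \in N[b] -> c != a.
  by move/notNa; apply: contraNneq => ->; apply: closed_nbhd_refl.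
have nbrD c : c \in N[b] -> c != b -> N[c] :&: D = [set b; c].
  move=> cb c_b; apply/esym/eqP.
  rewrite eqEcard cardD ?neq_a // cards2 eq_sym c_b andbT.
  rewrite subUset !sub1set !in_setI !(in_setU _ N[a]).
  by rewrite !closed_nbhd_refl (closed_nbhdC _ b) cb !orbT.
have disj c : c \in N[b] -> c != b -> [disjoint N[a] & N[c]].
  move=> cb c_b; apply/pred0P => v /=; apply/negP => /andP[va vc].
  have : v \in N[c] :&: D by rewrite in_setI vc in_setU va.
  rewrite nbrD // in_set2 => /orP[] /eqP vE;
    by move: va; rewrite vE; apply/negP/notNa; rewrite ?closed_nbhd_refl.
have notN c d : c \in N[b] -> c != b -> d \in N[b] -> d != b -> c != d ->
    c \notin N[d].
  move=> cb c_b db d_b cd; apply/negP => cNd.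
  have : c \in N[d] :&: D by rewrite in_setI cNd in_setU cb orbT.
  by rewrite nbrD // in_set2 (negPf c_b) (negPf cd).
(* Otherwise d and its two closed neighbours outside D would be three members
   of N[d] outside N[a] :|: N[c]. *)
have common c d : c \in N[b] -> c != b -> d \in N[b] -> d != b -> c != d ->
    exists2 p, p \in ~: D & (p \in N[c]) && (p \in N[d]).
  move=> cb c_b db d_b cd.
  case: (pickP [pred p in ~: D | (p \in N[c]) && (p \in N[d])]) => [p|none].
    by case/andP; exists p.
  have := outside_le2 _ a c d Gc G14 le12 (disj _ cb c_b).
  suff /subset_leq_card : d |: (N[d] :\: D) \subset N[d] :\: (N[a] :|: N[c]).
    rewrite cardsU1 (outside_card2 _ a b) ?neq_a // in_setD in_setU db orbT /=.
    by move=> /leq_trans/[apply].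
  rewrite subUset sub1set in_setD closed_nbhd_refl in_setU negb_or notNa //=.
  rewrite notN //= 1?eq_sym //; apply/subsetP => p.
  rewrite !in_setD !(in_setU _ N[a]) !negb_or => /andP[/andP[pa pb] pd].
  rewrite pa pd /= andbT; apply/negP => pc.
  by have := none p; rewrite /= in_setC (in_setU _ N[a]) negb_or pa pb pc pd.
have /card_gt2P[b1 [b2 [b3 [[e1 e2 e3] [n12 n23 n31]]]]] :
    2 < #|[set u | edge b u]| by have := Gc b; rewrite /degree => ->.
have nbr c : c \in [set u | edge b u] -> (c \in N[b]) * (c != b).
  move=> bc; split; first by rewrite in_setU bc orbT.
  by apply: contraTneq bc => ->; rewrite inE edge_irr.
have [[[c1 m1] [c2 m2]] [c3 m3]] := (nbr _ e1, nbr _ e2, nbr _ e3).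
have [p pD /andP[p2 p3]] := common _ _ c2 m2 c3 m3 n23.
have [pa pb] : p \notin N[a] /\ p \notin N[b].
  by apply/andP; rewrite -negb_or -(in_setU _ N[a]) -in_setC.
have p_neq c : c \in N[b] -> p != c by move=> cb; apply: contraNneq pb => ->.
(* Either N[p] meets D in three vertices, or N[p] contains the three vertices
   p, b2, b3 outside N[a] :|: N[b1]. *)
have [p1|p1] := boolP (p \in N[b1]).
  have : #|[set b1; b2; b3]| <= #|N[p] :&: D|.
    apply: subset_leq_card; rewrite !subUset !sub1set !(in_setI _ N[p]).
    by rewrite !(in_setU _ N[a]) !(closed_nbhdC _ _ p) c1 c2 c3 p1 p2 p3 !orbT.
  have p_a : p != a by apply: contraNneq pa => ->; apply: closed_nbhd_refl.
  by rewrite cards3 // cardD // p_neq // closed_nbhd_refl.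
have := outside_le2 _ a b1 p Gc G14 le12 (disj _ c1 m1); rewrite leqNgt => /negP.
apply; have <- : #|[set p; b2; b3]| = 3.
  by apply: cards3; rewrite ?p_neq // eq_sym p_neq.
apply: subset_leq_card; rewrite !subUset !sub1set !in_setD.
rewrite !(in_setU _ N[a]) !(closed_nbhdC _ _ p) p2 p3 closed_nbhd_refl.
by rewrite !negb_or pa p1 !notNa // !notN // eq_sym.
Qed.

Theorem theorem3p1 (G : sgraph) (n : nat)
    (Gconn : connected G) (Gcubic : cubic G)
    (Gorder : order_of G = n) (n14 : n = 14) :
  pd (7%:R / 8%:R : rat)%R G <= 4 /\
  (4%:R < 1 / 3%:R * n%:R :> rat)%R.
Proof.
rewrite {}n14 in Gorder *; split; last by lra.
apply/pd_leP; first by lra.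
have [a [b [c [d cover13]]]] :
    exists a b c d : G, 12 < #|N[a] :|: N[b] :|: N[c] :|: N[d]|.
  case: (pickP [pred q : G * G * G * G | 12 <
      #|N[q.1.1.1] :|: N[q.1.1.2] :|: N[q.1.2] :|: N[q.2]|]) => [q|none].
    by exists q.1.1.1, q.1.1.2, q.1.2, q.2.
  have [] := four_cover_le12_false G Gcubic Gorder.
  by move=> a b c d; rewrite leqNgt; apply/negbT; apply: (none (a, b, c, d)).
exists [set a; b; c; d].
  rewrite /partial_dominating Gorder /closed_nbhds !bigcup_setU !big_set1.
  have le13 : (7%:R / 8%:R * 14%:R <= 13%:R :> rat)%R by lra.
  by apply: Order.POrderTheory.le_trans le13 _; rewrite Num.Theory.ler_nat.
do 2 (apply: leq_trans (leq_card_setU _ _) _; rewrite cards1 addn1 ltnS).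
by rewrite cards2; case: (a != b).
Qed.
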